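(* Let $\mathcal{A}\in\mathbb{K}_l^{m\times r}$, $\mathcal{B}\in\mathbb{K}_l^{s\times n}$, $\mathcal{C}\in\mathbb{K}_l^{m\times n}$, let $\mathcal{M}\in\mathbb{K}_l^{r\times r}$ and $\mathcal{N}\in\mathbb{K}_l^{s\times s}$ be T-symmetric T-positive definite, and let $\mathcal{S}_1,\dots,\mathcal{S}_{q_{\mathcal{S}}}\in\mathbb{K}_l^{m\times\tau}$, $\mathcal{V}_1,\dots,\mathcal{V}_{q_{\mathcal{V}}}\in\mathbb{K}_l^{n\times\zeta}$ be given sketching tubal matrices. Let $$\mathcal{R}:=\mathbf{Range}\big(((\mathcal{N}^{-1})^{ST}*\mathcal{B}^{R})\otimes_t(\mathcal{M}^{-1}*\mathcal{A}^{T})\big).$$ Let $\mathcal{X}^{\star}$ satisfy $\mathcal{A}*\mathcal{X}^{\star}*\mathcal{B}=\mathcal{C}$. Let $\{\mathcal{X}^t\}_{t=0}^{\infty}$ be the iteration sequence calculated by the ATESP-MD method with initial iteration $\mathcal{X}^0$ satisfying $\mathrm{vec}_t(\mathcal{X}^{0})\in\mathcal{R}$: at each step choose $$(i^t,j^t)=\arg\max_{1\le i\le q_{\mathcal{S}},\,1\le j\le q_{\mathcal{V}}}f_{i,j}(\mathcal{X}^{t}),\qquad f_{i,j}(\mathcal{X})=\|\mathcal{A}*\mathcal{X}*\mathcal{B}-\mathcal{C}\|_{F(\mathcal{E}_i,\mathcal{G}_j)}^{2},$$ and set $\mathcal{X}^{t+1}=\mathcal{X}^{t}-\mathcal{M}^{-1}*\mathcal{A}^{T}*\mathcal{E}_{i^t}*(\mathcal{A}*\mathcal{X}^{t}*\mathcal{B}-\mathcal{C})*\mathcal{G}_{j^t}*\mathcal{B}^{T}*\mathcal{N}^{-1}$.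 Then $$\mathbb{E}[\|\mathcal{X}^{t}-\mathcal{X}^{\star}\|_{F(\mathcal{M},\mathcal{N})}^{2}\mid\mathcal{X}^{0}]\le\rho_{\text{ATESP-MD}}^{\,t}\,\|\mathcal{X}^{0}-\mathcal{X}^{\star}\|_{F(\mathcal{M},\mathcal{N})}^{2},\qquad \rho_{\text{ATESP-MD}}=1-\delta_{\infty}^{2},$$ where $$\delta_{\infty}^{2}=\min_{0\neq\overrightarrow{\mathcal{Y}}\in\mathcal{R}}\ \max_{1\le i\le q_{\mathcal{S}},\,1\le j\le q_{\mathcal{V}}}\frac{\|((\mathcal{N}^{\frac12})^{ST}\otimes_t\mathcal{M}^{\frac12})*\overrightarrow{\mathcal{Y}}\|^{2}_{\mathcal{W}_j^{ST}\otimes_t\mathcal{Z}_i}}{\|\overrightarrow{\mathcal{Y}}\|^{2}_{\mathcal{N}^{ST}\otimes_t\mathcal{M}}}.$$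
   Context: Fix $l\ge 1$. $\mathbb{K}_l^{m\times n}=\mathbb{R}^{m\times n\times l}$ (tubal matrices), $\mathbb{K}_l^{m}=\mathbb{K}_l^{m\times 1}$. $\mathcal{A}_{(k)}$ is the $k$-th frontal slice $\mathcal{A}(:,:,k)$. $\mathrm{unfold}(\mathcal{A})$ is the block column with blocks $\mathcal{A}_{(1)},\dots,\mathcal{A}_{(l)}$, $\mathrm{fold}$ is its inverse, and $\mathrm{bcirc}(\mathcal{A})$ is the block circulant matrix whose first block column is $\mathrm{unfold}(\mathcal{A})$ (block $(p,q)$ is $\mathcal{A}_{(((p-q)\bmod l)+1)}$). The t-product is $\mathcal{A}*\mathcal{B}=\mathrm{fold}(\mathrm{bcirc}(\mathcal{A})\,\mathrm{unfold}(\mathcal{B}))$. The identity $\mathcal{I}_n$ has first frontal slice the identity matrix and other slices zero; $\mathcal{A}^{-1}$ is the two-sided inverse with respect to $*$. Transpose: $(\mathcal{A}^{T})_{(1)}=\mathcal{A}_{(1)}^{T}$, $(\mathcal{A}^{T})_{(k)}=\mathcal{A}_{(l-k+2)}^{T}$ for $k\ge2$. Slice transpose: $(\mathcal{A}^{ST})_{(k)}=\mathcal{A}_{(k)}^{T}$ for all $k$. Reverse: $(\mathcal{A}^{R})_{(1)}=\mathcal{A}_{(1)}$, $(\mathcal{A}^{R})_{(k)}=\mathcal{A}_{(l-k+2)}$ for $k\ge2$. $\mathcal{A}^{\dag}$ is the unique Moore–Penrose inverse (the four Penrose equations with $*$ and ${}^T$). $\langle\cdot,\cdot\rangle$ is the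 entrywise inner product. $\mathcal{M}$ is T-symmetric if $\mathcal{M}=\mathcal{M}^{T}$, and T-symmetric T-positive (semi)definite if moreover $\langle\overrightarrow{\mathcal{X}},\mathcal{M}*\overrightarrow{\mathcal{X}}\rangle>0$ for all nonzero $\overrightarrow{\mathcal{X}}$ (resp. $\ge0$ for all $\overrightarrow{\mathcal{X}}$). $\mathcal{M}^{\frac12}$ is defined by $\mathrm{bcirc}(\mathcal{M}^{\frac12})=\mathrm{bcirc}(\mathcal{M})^{\frac12}$, and $\mathcal{M}^{-\frac12}=(\mathcal{M}^{\frac12})^{-1}$. $\mathrm{vec}_t(\mathcal{A})\in\mathbb{K}_l^{mn}$ stacks vertically the lateral slices $\mathcal{A}_{(:,1,:)},\dots,\mathcal{A}_{(:,n,:)}$. $\mathcal{A}\otimes_t\mathcal{B}$ is the block tubal matrix with $(i,j)$ block $\mathcal{A}_{(i,j,:)}*\mathcal{B}$ (the tube $\mathcal{A}_{(i,j,:)}\in\mathbb{K}_l^{1\times1}$ t-multiplied with every tube of $\mathcal{B}$). $\mathbf{Range}(\mathcal{A})=\{\mathcal{A}*\overrightarrow{\mathcal{X}}:\overrightarrow{\mathcal{X}}\in\mathbb{K}_l^{n}\}$. For T-symmetric T-positive semidefinite $\mathcal{D}$, $\|\overrightarrow{\mathcal{X}}\|_{\mathcal{D}}^2=\langle\mathcal{D}*\overrightarrow{\mathcal{X}},\overrightarrow{\mathcal{X}}\rangle$; for T-symmetric T-positive semidefinite $\mathcal{P},\mathcal{Q}$, $\|\mathcal{X}\|_{F(\mathcal{P},\mathcal{Q})}=\|\mathrm{vec}_t(\mathcal{X})\|_{\mathcal{Q}^{ST}\otimes_t\mathcal{P}}$.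 For $i\in\{1,\dots,q_{\mathcal{S}}\}$, $j\in\{1,\dots,q_{\mathcal{V}}\}$: $\mathcal{E}_i=\mathcal{S}_i*(\mathcal{S}_i^{T}*\mathcal{A}*\mathcal{M}^{-1}*\mathcal{A}^{T}*\mathcal{S}_i)^{\dag}*\mathcal{S}_i^{T}$, $\mathcal{G}_j=\mathcal{V}_j*(\mathcal{V}_j^{T}*\mathcal{B}^{T}*\mathcal{N}^{-1}*\mathcal{B}*\mathcal{V}_j)^{\dag}*\mathcal{V}_j^{T}$, $\mathcal{Z}_i=\mathcal{M}^{-\frac12}*\mathcal{A}^{T}*\mathcal{E}_i*\mathcal{A}*\mathcal{M}^{-\frac12}$, $\mathcal{W}_j=\mathcal{N}^{-\frac12}*\mathcal{B}*\mathcal{G}_j*\mathcal{B}^{T}*\mathcal{N}^{-\frac12}$.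
   Formalization: The formal theorem additionally assumes that vec_t(X* ) lies in R; for an arbitrary solution X* of A*X**B=C the stated bound is false (e.g. l=1, A=[1 0], B=1, M=I, N=1, C=0, X^0=0, X*=(0,1)^T). *)

(* Defs.v *)
(* MathComp / MathComp-Analysis *)
From HB Require Import structures.
From mathcomp Require Export all_boot all_order all_algebra.
From mathcomp Require Export all_classical all_reals all_analysis.

Set Implicit Arguments.
Unset Strict Implicit.
Unset Printing Implicit Defensive.

Import Order.TTheory GRing.Theory Num.Theory.

Local Open Scope classical_set_scope.
Local Open Scope ring_scope.

(* An m x n x l array is the family of its frontal slices, indexed from 0.  The
   operations take the tube length in the form l.+1 (i.e. at least 1), so that
   indices add and subtract modulo the tube length in the cyclic group 'I_l.+1;
   the 1-based slice l - k + 2 (k >= 2) is then slice - k. *)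
Notation tubal R l m n := {ffun 'I_l -> 'M[R]_(m, n)}.

Section TubalAlgebra.
Variables (R : realType) (l : nat).
Implicit Types (m n p q : nat).
Local Notation K m n := (tubal R l.+1 m n).

Definition unfold m n (A : K m n) : 'M[R]_(\sum_(k < l.+1) m, n) :=
  \mxcol_(k < l.+1) A k.

Definition fold m n (U : 'M[R]_(\sum_(k < l.+1) m, n)) : K m n :=
  [ffun k => submxcol U k].

Definition bcirc m n (A : K m n) :
    'M[R]_(\sum_(p < l.+1) m, \sum_(q < l.+1) n) :=
  \mxblock_(p < l.+1, q < l.+1) A (p - q).

Definition tmul m n p (A : K m n) (B : K n p) : K m p :=
  fold (bcirc A *m unfold B).

Definition tid n : K n n := [ffun k => if k == 0 then 1%:M else 0].

Definition ttr m n (A : K m n) : K n m := [ffun k => (A (- k))^T].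

Definition sliceT m n (A : K m n) : K n m := [ffun k => (A k)^T].

Definition trev m n (A : K m n) : K m n := [ffun k => A (- k)].

(* Two-sided inverse, and 0 if there is none. *)
Definition tinv n (A : K n n) : K n n :=
  xget 0 [set B | tmul A B = tid n /\ tmul B A = tid n].

Definition tpinv m n (A : K m n) : K n m :=
  xget 0 [set X : K n m | [/\ tmul (tmul A X) A = A,
                              tmul (tmul X A) X = X,
                              ttr (tmul A X) = tmul A X &
                              ttr (tmul X A) = tmul X A]].

Definition tinner m n (X Y : K m n) : R :=
  \sum_k \sum_i \sum_j X k i j * Y k i j.

Definition tsymmetric n (M : K n n) : Prop := M = ttr M.

Definition tposdef n (M : K n n) : Prop :=
  tsymmetric M /\ forall x : K n 1, x != 0 -> 0 < tinner x (tmul M x).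

(* The principal square root of a symmetric positive semidefinite real matrix:
   its symmetric positive semidefinite square root. *)
Definition psd_sqrtmx n (A : 'M[R]_n) : 'M[R]_n :=
  xget 0 [set S : 'M[R]_n | [/\ S^T = S,
                                forall x : 'cV[R]_n, 0 <= (x^T *m S *m x) 0 0 &
                                S *m S = A]].

Definition tsqrt n (M : K n n) : K n n :=
  xget 0 [set H | bcirc H = psd_sqrtmx (bcirc M)].

Definition tsqrtinv n (M : K n n) : K n n := tinv (tsqrt M).

(* A column of n blocks of height m, the j-th one being A(:, j, :). *)
Definition vec_t m n (A : K m n) : K (\sum_(j < n) m) 1 :=
  [ffun k => \mxcol_(j < n) col j (A k)].

Definition tube m n (A : K m n) (i : 'I_m) (j : 'I_n) : K 1 1 :=
  [ffun k => (A k i j)%:M].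

Definition tube_mul m n (a : K 1 1) (B : K m n) : K m n :=
  [ffun k => \matrix_(u, v) (tmul a (tube B u v)) k 0 0].

Definition tkron m n p q (A : K m n) (B : K p q) :
    K (\sum_(i < m) p) (\sum_(j < n) q) :=
  [ffun k => \mxblock_(i < m, j < n) (tube_mul (tube A i j) B) k].

Definition trange m n (A : K m n) : set (K m 1) := range (fun x : K n 1 => tmul A x).

(* Squared (semi)norms ||x||_D ^ 2 and ||X||_F(P, Q) ^ 2. *)
Definition tnorm2 n (D : K n n) (x : K n 1) : R := tinner (tmul D x) x.

Definition tnormF2 m n (P : K m m) (Q : K n n) (X : K m n) : R :=
  tnorm2 (tkron (sliceT Q) P) (vec_t X).

End TubalAlgebra.

Notation "A *t B" := (tmul A B) (at level 40, left associativity) : ring_scope.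

Section SketchAndProject.
Variables (R : realType) (l m r s n tau zeta qS qV : nat).
Local Notation K m n := (tubal R l.+1 m n).
Variables (A : K m r) (B : K s n) (C : K m n) (M : K r r) (N : K s s).
(* There are qS.+1 and qV.+1 sketching tubal matrices. *)
Variables (S : 'I_qS.+1 -> K m tau) (V : 'I_qV.+1 -> K n zeta).

Definition skE i : K m m :=
  S i *t tpinv (ttr (S i) *t A *t tinv M *t ttr A *t S i) *t ttr (S i).

Definition skG j : K n n :=
  V j *t tpinv (ttr (V j) *t ttr B *t tinv N *t B *t V j) *t ttr (V j).

Definition skZ i : K r r :=
  tsqrtinv M *t ttr A *t skE i *t A *t tsqrtinv M.

Definition skW j : K s s :=
  tsqrtinv N *t B *t skG j *t ttr B *t tsqrtinv N.

Definition sk_range : set (K (\sum_(j < s) r) 1) :=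
  trange (tkron (sliceT (tinv N) *t trev B) (tinv M *t ttr A)).

Definition sk_loss (ij : 'I_qS.+1 * 'I_qV.+1) (X : K r s) : R :=
  tnormF2 (skE ij.1) (skG ij.2) (A *t X *t B - C).

Definition sk_step (ij : 'I_qS.+1 * 'I_qV.+1) (X : K r s) : K r s :=
  X - tinv M *t ttr A *t skE ij.1 *t (A *t X *t B - C)
        *t skG ij.2 *t ttr B *t tinv N.

(* A run of the max-distance method on the sample space Omega.  Only ties
   between maximizing index pairs leave any freedom, and these may be broken in
   an arbitrary, possibly random and history dependent, measurable way. *)
Definition ATESP_MD d (Omega : measurableType d) (X0 : K r s)
    (sel : nat -> Omega -> 'I_qS.+1 * 'I_qV.+1) (X : nat -> Omega -> K r s) :
    Prop :=
  [/\ forall t ij, measurable [set w | sel t w = ij],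
      forall w, X 0%N w = X0,
      forall t w ij, sk_loss ij (X t w) <= sk_loss (sel t w) (X t w) &
      forall t w, X t.+1 w = sk_step (sel t w) (X t w)].

Definition sk_quotient (Y : K (\sum_(j < s) r) 1) (ij : 'I_qS.+1 * 'I_qV.+1) : R :=
  tnorm2 (tkron (sliceT (skW ij.2)) (skZ ij.1))
         (tkron (sliceT (tsqrt N)) (tsqrt M) *t Y)
  / tnorm2 (tkron (sliceT N) M) Y.

(* Seeding the iterated maximum with one of its own terms makes it the maximum
   over all index pairs, with no default value involved. *)
Definition sk_max_quotient (Y : K (\sum_(j < s) r) 1) : R :=
  \big[Num.max/sk_quotient Y (ord0, ord0)]_ij sk_quotient Y ij.

Definition sk_delta2 : R :=
  inf [set sk_max_quotient Y | Y in [set Y | sk_range Y /\ Y != 0]].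

Definition sk_rho : R := 1 - sk_delta2.

End SketchAndProject.

(* Main.v *)
From HB Require Import structures.
Require Import Defs.

Set Implicit Arguments.
Unset Strict Implicit.
Unset Printing Implicit Defensive.

Import Order.TTheory GRing.Theory Num.Theory.
Local Open Scope classical_set_scope.
Local Open Scope ring_scope.

(** Since [(Q^ST (x)_t P) * vec X = vec (P * X * Q)], one has
    [||X||_F(P,Q)^2 = <P * X * Q, X>], and the quotient defining
    [delta_infty^2] at [vec X] is
    [||A * X * B||_F(E_i,G_j)^2 / ||X||_F(M,N)^2].  Because
    [E_i * (A * M^-1 * A^T) * E_i = E_i], and similarly for [G_j], a step
    subtracts from the error its [F(M,N)]-orthogonal projection, whose squared
    norm is the loss [f_ij].  Hence the squared error decreases by the largest
    loss, which is at least [delta_infty^2] times the squared error as long as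
    the error stays in the range, as it does for every realization of the
    tie-breaking.  The minimum is attained because the quotients are continuous
    and homogeneous of degree 0. *)

Section TubalAlgebra.
Variables (R : realType) (l : nat).
Implicit Types (m n p q : nat).
Local Notation K m n := (tubal R l.+1 m n).

Lemma tmulE m n p (A : K m n) (B : K n p) (k : 'I_l.+1) :
  (A *t B) k = \sum_q A (k - q) *m B q.
Proof.
by rewrite ffunE /bcirc /unfold mxblockEv mxcol_mul mxcolK mul_mxrow_mxcol.
Qed.

Lemma tmulA m n p q (A : K m n) (B : K n p) (C : K p q) :
  A *t (B *t C) = A *t B *t C.
Proof.
apply/ffunP => k; rewrite !tmulE.
transitivity (\sum_a \sum_b A (k - a) *m (B (a - b) *m C b)).
  by apply: eq_bigr => a _; rewrite [(B *t C) _]tmulE mulmx_sumr.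
rewrite exchange_big /=; apply: eq_bigr => b _.
rewrite [(A *t B) _]tmulE mulmx_suml (reindex_inj (addIr b)) /=.
apply: eq_bigr => a _.
by rewrite mulmxA addrK opprD addrA (addrAC k).
Qed.

Lemma tmulDl m n p (A B : K m n) (C : K n p) :
  (A + B) *t C = A *t C + B *t C.
Proof.
apply/ffunP => k; rewrite !ffunE -!linearD /=; congr (submxcol _ k).
rewrite -mulmxDl; congr (_ *m _); rewrite /bcirc -mxblockD.
by apply: eq_mxblock => i j; rewrite ffunE.
Qed.

Lemma tmulDr m n p (A : K m n) (B C : K n p) :
  A *t (B + C) = A *t B + A *t C.
Proof.
apply/ffunP => k; rewrite [RHS]ffunE !tmulE -big_split /=.
by apply: eq_bigr => q _; rewrite ffunE mulmxDr.
Qed.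

Lemma tmulZl m n p a (A : K m n) (B : K n p) : (a *: A) *t B = a *: (A *t B).
Proof.
apply/ffunP => k; rewrite [RHS]ffunE !tmulE scaler_sumr.
by apply: eq_bigr => q _; rewrite ffunE -scalemxAl.
Qed.

Lemma tmulZr m n p a (A : K m n) (B : K n p) : A *t (a *: B) = a *: (A *t B).
Proof.
apply/ffunP => k; rewrite [RHS]ffunE !tmulE scaler_sumr.
by apply: eq_bigr => q _; rewrite ffunE -scalemxAr.
Qed.

Lemma tmulNl m n p (A : K m n) (B : K n p) : (- A) *t B = - (A *t B).
Proof. by rewrite -scaleN1r tmulZl scaleN1r. Qed.

Lemma tmulNr m n p (A : K m n) (B : K n p) : A *t (- B) = - (A *t B).
Proof. by rewrite -scaleN1r tmulZr scaleN1r. Qed.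

Lemma tmulBl m n p (A B : K m n) (C : K n p) :
  (A - B) *t C = A *t C - B *t C.
Proof. by rewrite tmulDl tmulNl. Qed.

Lemma tmulBr m n p (A : K m n) (B C : K n p) :
  A *t (B - C) = A *t B - A *t C.
Proof. by rewrite tmulDr tmulNr. Qed.

Lemma tmul0l m n p (B : K n p) : (0 : K m n) *t B = 0.
Proof. by rewrite -[0](scale0r 0) tmulZl scale0r. Qed.

Lemma tmul0r m n p (A : K m n) : A *t (0 : K n p) = 0.
Proof. by rewrite -[0](scale0r 0) tmulZr scale0r. Qed.

Lemma tmul1l m n (A : K m n) : tid R l m *t A = A.
Proof.
apply/ffunP => k; rewrite tmulE (bigD1 k) //= ffunE subrr eqxx mul1mx.
rewrite big1 ?addr0 // => q /negPf qk.
by rewrite ffunE subr_eq0 eq_sym qk mul0mx.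
Qed.

Lemma tmul1r m n (A : K m n) : A *t tid R l n = A.
Proof.
apply/ffunP => k; rewrite tmulE (bigD1 0) //= ffunE subr0 eqxx mulmx1.
by rewrite big1 ?addr0 // => q /negPf q0; rewrite ffunE q0 mulmx0.
Qed.

Lemma ttrK m n (A : K m n) : ttr (ttr A) = A.
Proof. by apply/ffunP => k; rewrite !ffunE opprK trmxK. Qed.

Lemma ttr_mul m n p (A : K m n) (B : K n p) :
  ttr (A *t B) = ttr B *t ttr A.
Proof.
apply/ffunP => k; rewrite ffunE !tmulE linear_sum /=.
rewrite (reindex_inj (addIr (- k))); apply: eq_bigr => q _ /=.
by rewrite trmx_mul !ffunE !opprB addKr.
Qed.

Lemma ttr0 m n : ttr (0 : K m n) = 0.
Proof. by apply/ffunP => k; rewrite !ffunE linear0. Qed.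

Lemma ttr1 n : ttr (tid R l n) = tid R l n.
Proof.
by apply/ffunP => k; rewrite !ffunE oppr_eq0; case: eqP; rewrite ?trmx1 ?trmx0.
Qed.

Lemma bcirc_mul m n p (A : K m n) (B : K n p) :
  bcirc (A *t B) = bcirc A *m bcirc B.
Proof.
rewrite /bcirc mul_mxblock; apply: eq_mxblock => i j.
rewrite tmulE (reindex_inj (addIr (- j))); apply: eq_bigr => q _ /=.
by rewrite opprB addrA subrK.
Qed.

Lemma bcirc_tr m n (A : K m n) : bcirc (ttr A) = (bcirc A)^T.
Proof.
by rewrite /bcirc tr_mxblock; apply: eq_mxblock => i j; rewrite ffunE opprB.
Qed.

Lemma bcirc_inj m n : injective (@bcirc R l m n).
Proof.
move=> A B; rewrite /bcirc => /eq_mxblockP AB; apply/ffunP => k.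
by have := AB k 0; rewrite subr0.
Qed.

Lemma bcirc0 m n : bcirc (0 : K m n) = 0.
Proof. by rewrite -mxblock0; apply: eq_mxblock => i j; rewrite ffunE. Qed.

Lemma foldK m n : cancel (@fold R l m n) (@unfold R l m n).
Proof.
by move=> U; rewrite -[RHS]submxcolK; apply: eq_mxcol => k; rewrite ffunE.
Qed.

Lemma unfoldK m n : cancel (@unfold R l m n) (@fold R l m n).
Proof. by move=> A; apply/ffunP => k; rewrite ffunE mxcolK. Qed.

Lemma unfold_mul m n p (A : K m n) (B : K n p) :
  unfold (A *t B) = bcirc A *m unfold B.
Proof. exact: foldK. Qed.

Lemma tinnerE m n (X Y : K m n) : tinner X Y = \tr ((ttr X *t Y) 0).
Proof.
rewrite tmulE /tinner linear_sum /=; apply: eq_bigr => k _.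
rewrite sub0r ffunE opprK /mxtrace exchange_big /=; apply: eq_bigr => j _.
by rewrite mxE; apply: eq_bigr => i _; rewrite mxE.
Qed.

Lemma tinner_unfold m n (X Y : K m n) :
  tinner X Y = \tr ((unfold X)^T *m unfold Y).
Proof.
rewrite tinnerE tmulE /unfold tr_mxcol mul_mxrow_mxcol; congr mxtrace.
by apply: eq_bigr => q _; rewrite ffunE sub0r opprK.
Qed.

Lemma ttrace_mulC m n (U : K m n) (W : K n m) :
  \tr ((U *t W) 0) = \tr ((W *t U) 0).
Proof.
rewrite !tmulE !linear_sum /= (reindex_inj (@oppr_inj _)) /=.
by apply: eq_bigr => q _; rewrite mxtrace_mulC !sub0r opprK.
Qed.

Lemma ttrace_tr n (U : K n n) : \tr (ttr U 0) = \tr (U 0).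
Proof. by rewrite ffunE oppr0 mxtrace_tr. Qed.

Lemma tinnerC m n (X Y : K m n) : tinner X Y = tinner Y X.
Proof. by rewrite !tinnerE -ttrace_tr ttr_mul ttrK. Qed.

Lemma tinner_mull m n p (A : K m n) (X : K n p) (Y : K m p) :
  tinner (A *t X) Y = tinner X (ttr A *t Y).
Proof. by rewrite !tinnerE ttr_mul tmulA. Qed.

Lemma tinner_mulr m n p (B : K n p) (X : K m n) (Y : K m p) :
  tinner (X *t B) Y = tinner X (Y *t ttr B).
Proof. by rewrite !tinnerE ttr_mul -tmulA ttrace_mulC tmulA. Qed.

Lemma tinnerDl m n (X Y W : K m n) :
  tinner (X + Y) W = tinner X W + tinner Y W.
Proof.
rewrite /tinner -big_split; apply: eq_bigr => k _; rewrite -big_split.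
apply: eq_bigr => i _; rewrite -big_split; apply: eq_bigr => j _ /=.
by rewrite ffunE mxE mulrDl.
Qed.

Lemma tinnerZl m n a (X W : K m n) : tinner (a *: X) W = a * tinner X W.
Proof.
rewrite /tinner mulr_sumr; apply: eq_bigr => k _; rewrite mulr_sumr.
apply: eq_bigr => i _; rewrite mulr_sumr; apply: eq_bigr => j _ /=.
by rewrite ffunE mxE mulrA.
Qed.

Lemma tinnerDr m n (X Y W : K m n) :
  tinner W (X + Y) = tinner W X + tinner W Y.
Proof. by rewrite tinnerC tinnerDl !(tinnerC W). Qed.

Lemma tinnerZr m n a (X W : K m n) : tinner W (a *: X) = a * tinner W X.
Proof. by rewrite tinnerC tinnerZl tinnerC. Qed.

Lemma tinnerNl m n (X W : K m n) : tinner (- X) W = - tinner X W.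
Proof. by rewrite -scaleN1r tinnerZl mulN1r. Qed.

Lemma tinnerNr m n (X W : K m n) : tinner W (- X) = - tinner W X.
Proof. by rewrite tinnerC tinnerNl tinnerC. Qed.

Lemma tinner0l m n (X : K m n) : tinner 0 X = 0.
Proof. by rewrite -(scale0r X) tinnerZl mul0r. Qed.

Lemma tinner0r m n (X : K m n) : tinner X 0 = 0.
Proof. by rewrite tinnerC tinner0l. Qed.

Lemma tinner_bcirc m n (X Y : K m n) :
  \tr ((bcirc X)^T *m bcirc Y) = l.+1%:R * tinner X Y.
Proof.
rewrite -bcirc_tr -bcirc_mul tinnerE /bcirc mxtrace_mxblock.
under eq_bigr do rewrite subrr.
by rewrite sumr_const card_ord mulr_natl.
Qed.

End TubalAlgebra.

Section Vectorization.
Variables (R : realType) (l : nat).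
Implicit Types (m n p q : nat).
Local Notation K m n := (tubal R l.+1 m n).

Lemma tmulEr m n p (A : K m n) (B : K n p) (k : 'I_l.+1) :
  (A *t B) k = \sum_q A q *m B (k - q).
Proof.
rewrite tmulE (reindex_inj (inv_inj (@subKr _ k))) /=.
by apply: eq_bigr => q _; rewrite subKr.
Qed.

Lemma sliceT_mul m n p (A : K m n) (B : K n p) :
  sliceT (A *t B) = sliceT B *t sliceT A.
Proof.
apply/ffunP => k; rewrite ffunE tmulEr tmulE linear_sum /=.
by apply: eq_bigr => q _; rewrite trmx_mul !ffunE.
Qed.

Lemma sliceT_ttr m n (A : K m n) : sliceT (ttr A) = trev A.
Proof. by apply/ffunP => k; rewrite !ffunE trmxK. Qed.

Lemma tube_mulE m n p q (A : K m n) (B : K p q) i j (k : 'I_l.+1) :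
  tube_mul (tube A i j) B k = \sum_h A (k - h) i j *: B h.
Proof.
rewrite ffunE; apply/matrixP => u v. rewrite mxE tmulE !summxE.
by apply: eq_bigr => h _; rewrite !ffunE mxE big_ord1 !mxE eqxx !mulr1n.
Qed.

Lemma col_mulmx_sum m n p (A : 'M[R]_(m, n)) (B : 'M[R]_(n, p)) i :
  col i (A *m B) = \sum_j B j i *: col j A.
Proof.
apply/colP => u; rewrite summxE !mxE.
by apply: eq_bigr => j _; rewrite !mxE mulrC.
Qed.

Lemma tkron_vec m n p q (P : K p m) (X : K m n) (Q : K n q) :
  tkron (sliceT Q) P *t vec_t X = vec_t (P *t X *t Q).
Proof.
apply/ffunP => k; rewrite [RHS]ffunE [LHS]tmulE.
transitivity (\sum_h \mxcol_(i < q) \sum_(j < n)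
    tube_mul (tube (sliceT Q) i j) P (k - h) *m col j (X h)).
  by apply: eq_bigr => h _; rewrite !ffunE mul_mxblock_mxrow.
rewrite -mxcol_sum; apply: eq_mxcol => i; rewrite -tmulA tmulEr linear_sum /=.
transitivity (\sum_h \sum_u \sum_(j < n)
    Q (k - h - u) j i *: (P u *m col j (X h))).
  apply: eq_bigr => h _; rewrite exchange_big; apply: eq_bigr => j _.
  rewrite tube_mulE mulmx_suml; apply: eq_bigr => u _.
  by rewrite !ffunE mxE scalemxAl.
rewrite exchange_big /=; apply: eq_bigr => u _.
rewrite [in RHS]colE -mulmxA -colE tmulEr linear_sum mulmx_sumr.
apply: eq_bigr => h _ /=; rewrite col_mulmx_sum mulmx_sumr.
by apply: eq_bigr => j _; rewrite -scalemxAr addrAC.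
Qed.

Definition mat_t m n (y : K (\sum_(j < n) m) 1) : K m n :=
  [ffun k => \matrix_(i, j) submxcol (y k) j i 0].

Lemma mat_tK m n : cancel (@mat_t m n) (@vec_t R l m n).
Proof.
move=> y; apply/ffunP => k; rewrite ffunE -[RHS]submxcolK.
apply: eq_mxcol => j; apply/matrixP => i z.
by rewrite ffunE 2!mxE (ord1 z).
Qed.

Lemma vec_t_inj m n : injective (@vec_t R l m n).
Proof.
move=> X Y /ffunP XY; apply/ffunP => k; apply/matrixP => i j.
have := XY k; rewrite !ffunE => /eq_mxcolP/(_ j)/matrixP/(_ i 0).
by rewrite !mxE.
Qed.

Lemma vec_tD m n (X Y : K m n) : vec_t (X + Y) = vec_t X + vec_t Y.
Proof.
apply/ffunP => k; rewrite !ffunE -mxcolD; apply: eq_mxcol => j.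
by rewrite linearD.
Qed.

Lemma vec_tZ m n a (X : K m n) : vec_t (a *: X) = a *: vec_t X.
Proof.
apply/ffunP => k; rewrite !ffunE; apply/matrixP => i z.
by rewrite !mxE.
Qed.

Lemma vec_tB m n (X Y : K m n) : vec_t (X - Y) = vec_t X - vec_t Y.
Proof. by rewrite -scaleN1r vec_tD vec_tZ scaleN1r. Qed.

Lemma vec_t0 m n : vec_t (0 : K m n) = 0.
Proof. by rewrite -(scale0r 0) vec_tZ scale0r. Qed.

Lemma tinner_vec m n (X Y : K m n) : tinner (vec_t X) (vec_t Y) = tinner X Y.
Proof.
rewrite !tinnerE !tmulE !linear_sum /=; apply: eq_bigr => k _.
rewrite !ffunE sub0r opprK tr_mxcol mul_mxrow_mxcol linear_sum /=.
apply: eq_bigr => j _; rewrite /mxtrace big_ord1 !mxE.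
by apply: eq_bigr => i _; rewrite !mxE.
Qed.

Lemma tnormF2E m n (P : K m m) (Q : K n n) (X : K m n) :
  tnormF2 P Q X = tinner (P *t X *t Q) X.
Proof. by rewrite /tnormF2 /tnorm2 tkron_vec tinner_vec. Qed.

End Vectorization.

Section PositiveDefinite.
Variables (R : realType) (l : nat).
Implicit Types (m n p q : nat).
Local Notation K m n := (tubal R l.+1 m n).

Lemma cholesky n (M : 'M[R]_n) :
    M^T = M -> (forall x : 'cV_n, x != 0 -> 0 < (x^T *m M *m x) 0 0) ->
  exists L : 'M[R]_n, L^T *m L = M.
Proof.
elim: n M => [|n IHn]; first by exists 0; rewrite !flatmx0.
rewrite -[n.+1]/(1 + n)%N => M Msym Mpos.
pose a := M 0 0; pose u := ursubmx M; pose D := drsubmx M.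
have ME : M = block_mx a%:M u u^T D.
  rewrite -[LHS]submxK [X in block_mx X]mx11_scalar.
  congr (block_mx _%:M _ _ _); last by rewrite -[in LHS]Msym -trmx_ursub.
  by rewrite !mxE; congr (M _ _); apply: val_inj.
have a_gt0 : 0 < a.
  have := Mpos (col_mx 1%:M 0 : 'cV_(1 + n)); rewrite ME tr_col_mx trmx1 trmx0.
  rewrite mul_row_block mul_row_col !mulmx0 !mul0mx !addr0 mulmx1 mul1mx mxE.
  by rewrite mulr1n; apply; rewrite col_mx_eq0 negb_and oner_neq0.
have [|y y0|L LE] := IHn (D - a^-1 *: (u^T *m u)).
- rewrite linearB linearZ /= trmx_mul trmxK /D; congr (_ - _).
  by rewrite trmx_drsub Msym.
- have := Mpos (col_mx (- a^-1 *: (u *m y)) y : 'cV_(1 + n)).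
  rewrite col_mx_eq0 (negPf y0) andbF => /(_ isT).
  rewrite ME tr_col_mx -mulmxA mul_block_col mul_row_col mul_scalar_mx scalerA.
  rewrite mulrN divff ?gt_eqF // scaleN1r addNr mulmx0 add0r.
  rewrite -mulmxA; congr (0 < (_ *m _) _ _).
  by rewrite mulmxBl addrC -scalemxAr -scalemxAl scaleNr mulmxA.
have s0 : Num.sqrt a != 0 by rewrite gt_eqF // sqrtr_gt0.
exists (block_mx (Num.sqrt a)%:M ((Num.sqrt a)^-1 *: u) 0 L : 'M[R]_(1 + n)).
rewrite [RHS]ME tr_block_mx mulmx_block !trmx0 !mulmx0 !mul0mx !addr0.
rewrite tr_scalar_mx -scalar_mxM -expr2 sqr_sqrtr ?ltW // mul_scalar_mx.
rewrite scalerA divff // scale1r mul_mx_scalar linearZ /= scalerA divff //.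
rewrite scale1r -scalemxAl -scalemxAr scalerA -invfM -expr2 sqr_sqrtr ?ltW //.
by rewrite LE addrC subrK.
Qed.

Lemma unfold0 m n : unfold (0 : K m n) = 0.
Proof. by rewrite -mxcol0; apply: eq_mxcol => k; rewrite ffunE. Qed.

Lemma bcirc_posdef n (M : K n n) (x : 'cV_(\sum_(k < l.+1) n)) : tposdef M ->
  x != 0 -> 0 < (x^T *m bcirc M *m x) 0 0.
Proof.
move=> [_ Mpos] x0; have := Mpos (fold x); rewrite tinner_unfold unfold_mul.
rewrite foldK mulmxA /mxtrace big_ord1; apply.
by apply: contraNneq x0 => fx; rewrite -(foldK x) fx unfold0.
Qed.

Lemma bcirc_posdefP n (M : K n n) : tposdef M ->
  exists2 L : 'M[R]_(\sum_(k < l.+1) n), L^T *m L = bcirc M &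
    forall p (X : 'M[R]_(\sum_(k < l.+1) n, p)), L *m X = 0 -> X = 0.
Proof.
move=> Mpos.
have [L LM] : exists L : 'M[R]_(\sum_(k < l.+1) n), L^T *m L = bcirc M.
  apply: cholesky => [|x]; last exact: (bcirc_posdef Mpos).
  by rewrite -bcirc_tr -Mpos.1.
exists L => // p X LX0; apply/matrixP => i j; rewrite mxE.
have [/colP/(_ i)|] := eqVneq (col j X) 0; first by rewrite !mxE.
move=> /(bcirc_posdef Mpos); rewrite -LM -!mulmxA.
rewrite [col j X]colE (mulmxA L) LX0 !mul0mx !mulmx0.
by rewrite mxE ltxx.
Qed.

(* Writing [bcirc M = L^T L] and [Z = L (bcirc X)], the number
   [l.+1 * <M X N, X>] is the sum of [z (bcirc N) z^T] over the rows [z] of [Z]. *)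
Lemma tposdef_tinner_gt0 m n (M : K m m) (N : K n n) (X : K m n) :
  tposdef M -> tposdef N -> X != 0 -> 0 < tinner (M *t X *t N) X.
Proof.
move=> Mpos Npos X0; have [L LM Linj] := bcirc_posdefP Mpos.
pose Z := L *m bcirc X.
have /matrix0Pn[i [j Zij]] : Z != 0.
  apply: contra_neq X0 => /Linj; rewrite -(@bcirc0 R l m n).
  exact: bcirc_inj.
rewrite -(pmulr_rgt0 _ (ltr0Sn R l)) tinnerC -tinner_bcirc !bcirc_mul -LM.
rewrite !mulmxA -trmx_mul -(mulmxA _ L) -/Z -mulmxA mxtrace_mulC /mxtrace.
have rowE k : (Z *m bcirc N *m Z^T) k k =
    (row k Z *m bcirc N *m (row k Z)^T) 0 0.
  by rewrite -!row_mul !mxE; apply: eq_bigr => u _; rewrite !mxE.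
have row_ge0 k : 0 <= (Z *m bcirc N *m Z^T) k k.
  rewrite rowE; have [->|z0] := eqVneq (row k Z)^T 0.
    by rewrite mulmx0 mxE.
  by have := ltW (bcirc_posdef Npos z0); rewrite trmxK.
rewrite (bigD1 i) //= ltr_pwDl ?sumr_ge0 // rowE.
have /(bcirc_posdef Npos) : (row i Z)^T != 0.
  by apply: contraNneq Zij => /colP/(_ j); rewrite !mxE => ->.
by rewrite trmxK.
Qed.

Lemma tposdef_tinner_ge0 m n (M : K m m) (N : K n n) (X : K m n) :
  tposdef M -> tposdef N -> 0 <= tinner (M *t X *t N) X.
Proof.
move=> Mpos Npos; have [->|X0] := eqVneq X 0; first by rewrite tinner0r.
exact/ltW/tposdef_tinner_gt0.
Qed.

Lemma tinv_def n (M : K n n) :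
  (exists B, M *t B = tid R l n /\ B *t M = tid R l n) ->
  M *t tinv M = tid R l n /\ tinv M *t M = tid R l n.
Proof.
exact: (@xgetPex _ 0 [set B | M *t B = tid R l n /\ B *t M = tid R l n]).
Qed.

Lemma tinv_posdef n (M : K n n) : tposdef M ->
  [/\ M *t tinv M = tid R l n, tinv M *t M = tid R l n & ttr (tinv M) = tinv M].
Proof.
move=> Mpos; have [Msym _] := Mpos.
have bM : bcirc M \in unitmx.
  rewrite -row_free_unit; apply/inj_row_free => v vM0.
  apply/eqP; rewrite -(inj_eq trmx_inj) trmx0; apply: contraTT isT.
  by move=> /(bcirc_posdef Mpos); rewrite trmxK vM0 mul0mx mxE ltxx.
pose B := fold (invmx (bcirc M) *m unfold (tid R l n)).
have MB : M *t B = tid R l n.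
  apply: (can_inj (@unfoldK _ _ _ _)).
  by rewrite unfold_mul foldK mulmxA mulmxV // mul1mx.
have BM : ttr B *t M = tid R l n by rewrite {1}Msym -ttr_mul MB ttr1.
have BB : ttr B = B by rewrite -[LHS]tmul1r -MB tmulA BM tmul1l.
have [MV VM] : M *t tinv M = tid R l n /\ tinv M *t M = tid R l n.
  by apply: tinv_def; exists B; rewrite -{2}BB.
have -> : tinv M = B by rewrite -[LHS]tmul1r -MB tmulA VM tmul1l.
by split => //; rewrite -BB.
Qed.

End PositiveDefinite.

Section SketchOperator.
Variables (R : realType) (l : nat).
Implicit Types (m n p q : nat).
Local Notation K m n := (tubal R l.+1 m n).

Definition penrose m n (A : K m n) (X : K n m) :=
  [/\ A *t X *t A = A, X *t A *t X = X,
      ttr (A *t X) = A *t X & ttr (X *t A) = X *t A].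

Lemma penrose_unique m n (A : K m n) X Y :
  penrose A X -> penrose A Y -> X = Y.
Proof.
move=> [AXA XAX AX XA] [AYA YAY AY YA].
have AXY : A *t X = A *t Y.
  have : ttr (A *t X *t (A *t Y)) = A *t Y by rewrite tmulA AXA AY.
  by rewrite ttr_mul AY AX tmulA AYA.
have XYA : X *t A = Y *t A.
  have : ttr (X *t A *t (Y *t A)) = X *t A by rewrite -tmulA (tmulA A) AYA XA.
  by rewrite ttr_mul YA XA -tmulA (tmulA A) AXA.
by rewrite -XAX XYA -tmulA AXY tmulA YAY.
Qed.

Lemma penrose_ttr n (A X : K n n) :
  ttr A = A -> penrose A X -> penrose A (ttr X).
Proof.
move=> AT [AXA XAX AX XA].
have AXT : A *t ttr X = X *t A by rewrite -[RHS]XA ttr_mul AT.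
have XTA : ttr X *t A = A *t X by rewrite -[RHS]AX ttr_mul AT.
split; rewrite ?AXT ?XTA //.
- by rewrite -AXT -[RHS]AT -[in RHS]AXA !ttr_mul AT tmulA.
- by rewrite -XTA -[in RHS]XAX !ttr_mul AT tmulA.
Qed.

(* [tpinv A] is [0] when [A] has no Moore-Penrose inverse; the properties below
   hold for this junk value too, so existence need not be established. *)
Lemma tpinv_spec m n (A : K m n) : penrose A (tpinv A) \/ tpinv A = 0.
Proof.
rewrite /tpinv -/(penrose A); case: (pselect (exists X, penrose A X)) => XA.
  by left; exact: (@xgetPex _ 0 (penrose A)).
by right; apply: xgetPN => X PX; apply: XA; exists X.
Qed.

Lemma tpinv_mulK m n (A : K m n) : tpinv A *t A *t tpinv A = tpinv A.
Proof. by have [[]//|->] := tpinv_spec A; rewrite tmul0r. Qed.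

Lemma tpinv_ttr n (A : K n n) : ttr A = A -> ttr (tpinv A) = tpinv A.
Proof.
move=> AT; have [PA|->] := tpinv_spec A; last exact: ttr0.
exact: penrose_unique (penrose_ttr AT PA) PA.
Qed.

Definition sketch m p (U : K m p) (A : K m m) : K m m :=
  U *t tpinv (ttr U *t A *t U) *t ttr U.

Lemma sketch_ttr m p (U : K m p) (A : K m m) :
  ttr A = A -> ttr (sketch U A) = sketch U A.
Proof.
move=> AT; rewrite /sketch !ttr_mul ttrK tpinv_ttr ?tmulA //.
by rewrite !ttr_mul ttrK AT tmulA.
Qed.

Lemma sketch_mulK m p (U : K m p) (A : K m m) :
  sketch U A *t A *t sketch U A = sketch U A.
Proof.
rewrite /sketch; have := tpinv_mulK (ttr U *t A *t U).
by move: (tpinv _) => H HK; rewrite -[in RHS]HK !tmulA.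
Qed.

Lemma tsqrt_spec n (M : K n n) :
  [/\ ttr (tsqrt M) = tsqrt M & tsqrt M *t tsqrt M = M] \/ tsqrt M = 0.
Proof.
rewrite /tsqrt; set Q := [set H | _].
case: (pselect (exists H, Q H)) => [/(@xgetPex _ 0)|]; last first.
  by move=> nQ; right; apply: xgetPN => H QH; apply: nQ; exists H.
move: (xget 0 Q) => H; rewrite /Q /= /psd_sqrtmx; set P := [set U | _].
case: (pselect (exists U, P U)) => [/(@xgetPex _ 0)|nP]; last first.
  rewrite xgetPN => [|U PU]; last by apply: nP; exists U.
  by rewrite -[RHS](bcirc0 R l n n) => /bcirc_inj; right.
move: (xget 0 P) => U [UT _ UU] HU; left; split; apply: bcirc_inj.
  by rewrite bcirc_tr HU.
by rewrite bcirc_mul HU.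
Qed.

Lemma tsqrtinv_spec n (M : K n n) : tposdef M ->
  [/\ ttr (tsqrt M) = tsqrt M, tsqrt M *t tsqrtinv M = tid R l n &
      tsqrtinv M *t tsqrt M = tid R l n] \/ tsqrt M = 0.
Proof.
move=> /tinv_posdef[MV VM _]; have [[HT HH]|] := tsqrt_spec M; [left|by right].
set H := tsqrt M in HT HH *.
have HV : H *t (H *t tinv M) = tid R l n by rewrite tmulA HH.
have VH : tinv M *t H *t H = tid R l n by rewrite -tmulA HH.
have [|HI IH] := @tinv_def _ _ _ H; last by split.
exists (H *t tinv M); split => //.
have -> : H *t tinv M = tinv M *t H.
  by rewrite -[LHS]tmul1l -VH -tmulA HV tmul1r.
by [].
Qed.

End SketchOperator.

Section MinimumOnSubspace.
Import numFieldNormedType.Exports.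
Variables (R : realType) (l : nat).
Local Notation K m n := (tubal R l.+1 m n).

Lemma rV_linear_continuous d (f : 'rV[R]_d -> R) : linear f -> continuous f.
Proof.
move=> fL; pose g : {linear 'rV[R]_d -> R^o} :=
  HB.pack f (GRing.isLinear.Build R 'rV[R]_d R^o _ f fL).
have -> : f = fun v => \sum_j v 0 j * f 'e_j.
  apply/funext => v; rewrite {1}[v]row_sum_delta -[f]/(g : _ -> _) linear_sum.
  by apply: eq_bigr => j _; rewrite linearZ.
apply: continuous_big => [|j _]; first exact: add_continuous.
move=> v; apply: continuousM; first exact: coord_continuous.
exact: cst_continuous.
Qed.

Lemma tinner_continuous d m n (F G : 'rV[R]_d -> K m n) :
  linear F -> linear G -> continuous (fun v => tinner (F v) (G v) : R).
Proof.
move=> FL GL; apply: continuous_big => [|k _]; first exact: add_continuous.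
apply: continuous_big => [|i _]; first exact: add_continuous.
apply: continuous_big => [|j _]; first exact: add_continuous.
by move=> v; apply: continuousM; apply: rV_linear_continuous => a x y;
  rewrite ?FL ?GL !(ffunE, mxE).
Qed.

Lemma bigmax_continuous (T : topologicalType) (I : Type) (r : seq I)
    (g : T -> R) (F : I -> T -> R) x :
  continuous_at x g -> (forall i, continuous_at x (F i)) ->
  continuous_at x (fun y => \big[Num.max/g y]_(i <- r) F i y).
Proof.
move=> gx Fx; elim: r => [|i r IHr].
  by rewrite (_ : (fun y => _) = g) //; apply/funext => y; rewrite big_nil.
rewrite (_ : (fun y => _) =
    F i \max (fun y => \big[Num.max/g y]_(j <- r) F j y)); last first.
  by apply/funext => y; rewrite big_cons.
exact: (@continuous_max R T (F i) _ x (Fx i) IHr).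
Qed.

(* The minimum over the unit sphere is a minimum over all nonzero vectors. *)
Lemma homogeneous_min d (phi : 'rV[R]_d -> R) :
    (exists v : 'rV[R]_d, v != 0) ->
    (forall v, v != 0 -> {for v, continuous phi}) ->
    (forall a v, a != 0 -> phi (a *: v) = phi v) ->
  exists2 v, v != 0 & forall w, w != 0 -> phi v <= phi w.
Proof.
move=> [v0 v0_neq0] phi_cont phi_hom.
pose sphere := [set v : 'rV[R]_d | `|v| = 1].
have normed v : v != 0 -> sphere (`|v|^-1 *: v).
  move=> v_neq0; rewrite /sphere /= normrZ normfV normr_id mulVf //.
  by rewrite normr_eq0.
have sphere_neq0 v : sphere v -> v != 0.
  by move=> v1; rewrite -normr_eq0 v1 oner_neq0.
have [|||v] := @compact_EVT_min _ R phi sphere.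
- by exists (`|v0|^-1 *: v0); exact: normed.
- apply: bounded_closed_compact.
    exists 1; split; first exact: num_real.
    by move=> a a1 v /= ->; exact: ltW.
  rewrite (_ : sphere = Num.norm @^-1` [set 1 : R]) //.
  apply: preimage_closed => [v _|]; first exact: norm_continuous.
  exact: closed_eq.
- apply: continuous_in_subspaceT => v; rewrite inE => /sphere_neq0.
  exact: phi_cont.
rewrite inE => v1 v_min; exists v; first exact: sphere_neq0.
move=> w w_neq0; rewrite -(phi_hom (`|w|^-1) w) ?invr_eq0 ?normr_eq0 //.
by apply: v_min; rewrite inE; exact: normed.
Qed.

Lemma trange_param m n (T : K m n) : exists d, exists Y : 'rV[R]_d -> K m 1,
  [/\ linear Y, forall v, v != 0 -> Y v != 0 &
      forall y, trange T y <-> exists v, y = Y v].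
Proof.
pose G := (bcirc T)^T; exists (\rank G).
pose Y (v : 'rV[R]_(\rank G)) : K m 1 := fold (v *m row_base G)^T.
have YL : linear Y.
  move=> a u v; apply/ffunP => k.
  rewrite !ffunE mulmxDl -scalemxAl linearP.
  by apply/matrixP => i j; rewrite !mxE.
exists Y; split => // [v|y].
  apply: contra_neq => Yv0; apply: (row_free_inj (row_base_free G)).
  rewrite mul0mx; apply/trmx_inj.
  by rewrite -[LHS]foldK -/(Y v) Yv0 unfold0 trmx0.
split=> [[x _ <-]|[v ->]].
  have /submxP[v vE] : ((unfold x)^T *m G <= row_base G)%MS.
    by rewrite eq_row_base submxMl.
  by exists v; rewrite /Y -vE -trmx_mul trmxK -unfold_mul unfoldK.
have /submxP[w wE] : (v *m row_base G <= G)%MS.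
  by apply: submx_trans (submxMl _ _) _; rewrite eq_row_base.
exists (fold w^T) => //; apply: (can_inj (@unfoldK _ _ _ _)).
by rewrite unfold_mul !foldK wE trmx_mul trmxK.
Qed.

End MinimumOnSubspace.

Section SketchProjection.
Variables (R : realType) (l m r s n : nat).
Local Notation K m n := (tubal R l.+1 m n).
Variables (A : K m r) (B : K s n) (M : K r r) (N : K s s).
Variables (E : K m m) (G : K n n).
Hypotheses (hM : tposdef M) (hN : tposdef N).
Local Notation KA := (A *t tinv M *t ttr A).
Local Notation KB := (ttr B *t tinv N *t B).
Hypotheses (ET : ttr E = E) (EKE : E *t KA *t E = E).
Hypotheses (GT : ttr G = G) (GKG : G *t KB *t G = G).

Definition increment (e : K r s) : K r s :=
  tinv M *t ttr A *t E *t (A *t e *t B) *t G *t ttr B *t tinv N.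

Definition gain (e : K r s) : R := tnormF2 E G (A *t e *t B).

Lemma tinner_increment (e u : K r s) :
  tinner (M *t increment e *t N) u =
    tinner (E *t (A *t e *t B) *t G) (A *t u *t B).
Proof.
have [MV _ _] := tinv_posdef hM; have [_ NV _] := tinv_posdef hN.
have NVK (U : K r s) : U *t tinv N *t N = U by rewrite -tmulA NV tmul1r.
transitivity (tinner (ttr A *t (E *t (A *t e *t B) *t G) *t ttr B) u).
  by congr tinner; rewrite /increment !tmulA MV tmul1l NVK.
by rewrite tinner_mulr tinner_mull !ttrK !tmulA.
Qed.

Lemma ttrKA : ttr KA = KA.
Proof.
by have [_ _ MT] := tinv_posdef hM; rewrite !ttr_mul ttrK MT tmulA.
Qed.

Lemma ttrKB : ttr KB = KB.
Proof.
by have [_ _ NT] := tinv_posdef hN; rewrite !ttr_mul ttrK NT tmulA.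
Qed.

(* The increment is the [F(M, N)]-orthogonal projection of [e], and the gain its
   squared norm, because [E KA E = E] and [G KB G = G]. *)
Lemma normF2_increment (e : K r s) : tnormF2 M N (increment e) = gain e.
Proof.
rewrite /gain !tnormF2E tinner_increment; set D := A *t e *t B.
set W := E *t D *t G.
have -> : A *t increment e *t B = KA *t W *t KB.
  by rewrite /increment !tmulA.
rewrite {1}/W tinner_mulr tinner_mull ET GT tinnerC.
congr tinner; rewrite /W -[in RHS]EKE -[in RHS]GKG.
by move: KA KB => k k'; rewrite !tmulA.
Qed.

Lemma normF2_sub_increment (e : K r s) :
  tnormF2 M N (e - increment e) = tnormF2 M N e - gain e.
Proof.
have [[Msym _] [Nsym _]] := (hM, hN).
have ie : tinner (M *t increment e *t N) e = gain e.
  by rewrite tinner_increment /gain tnormF2E.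
have ei : tinner (M *t e *t N) (increment e) = gain e.
  by rewrite tinner_mulr tinner_mull -Msym -Nsym tinnerC tmulA.
have ii := normF2_increment e; rewrite tnormF2E in ii.
rewrite !tnormF2E tmulBr tmulBl !(tinnerDl, tinnerDr, tinnerNl, tinnerNr).
by rewrite ii ei ie subrr addr0.
Qed.

Lemma gain_ge0 (e : K r s) : 0 <= gain e.
Proof. by rewrite -normF2_increment tnormF2E; exact: tposdef_tinner_ge0. Qed.

Lemma gain_le (e : K r s) : gain e <= tnormF2 M N e.
Proof.
rewrite -subr_ge0 -normF2_sub_increment tnormF2E.
exact: tposdef_tinner_ge0.
Qed.

(* As far as this proof knows, either square root may be the junk value [0]; the
   left-hand side is then [0], which still bounds the gain from below. *)
Lemma whitened_gain (e : K r s) :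
  let HM := tsqrt M in let HN := tsqrt N in
  let Z := tsqrtinv M *t ttr A *t E *t A *t tsqrtinv M in
  let W := tsqrtinv N *t B *t G *t ttr B *t tsqrtinv N in
  let g := tnormF2 Z W (HM *t e *t HN) in g = gain e \/ g = 0.
Proof.
move=> HM HN Z W; rewrite /= tnormF2E.
have [[MT MH HMV]|] := tsqrtinv_spec hM; last first.
  by rewrite /HM => ->; rewrite !tmul0l tinner0r; right.
have [[NT NH HNV]|] := tsqrtinv_spec hN; last first.
  by rewrite /HN => ->; rewrite !tmul0r tinner0r; right.
left; rewrite -/HM -/HN in MT MH HMV NT NH HNV.
move: HM HN (tsqrtinv M) (tsqrtinv N) @Z @W MT MH HMV NT NH HNV.
move=> HM HN VM VN Z W MT MH HMV NT NH HNV.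
have HMK p (U : K p r) : U *t VM *t HM = U by rewrite -tmulA HMV tmul1r.
have HNK p (U : K p s) : U *t HN *t VN = U by rewrite -tmulA NH tmul1r.
have VNK p (U : K p s) : U *t VN *t HN = U by rewrite -tmulA HNV tmul1r.
rewrite tinnerC tinner_mulr tinner_mull MT NT /Z /W !tmulA.
rewrite MH tmul1l HMK HNK VNK.
transitivity (tinner e (ttr A *t (E *t (A *t e *t B) *t G) *t ttr B)).
  by rewrite !tmulA.
by rewrite tinnerC tinner_mulr tinner_mull !ttrK /gain tnormF2E !tmulA.
Qed.

End SketchProjection.

Section SketchAndProjectMethod.
Import numFieldNormedType.Exports.
Variables (R : realType) (l m r s n tau zeta qS qV : nat).
Local Notation K m n := (tubal R l.+1 m n).
Variables (A : K m r) (B : K s n) (C : K m n) (M : K r r) (N : K s s).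
Variables (S : 'I_qS.+1 -> K m tau) (V : 'I_qV.+1 -> K n zeta).
Hypotheses (hM : tposdef M) (hN : tposdef N).
Implicit Types (ij : 'I_qS.+1 * 'I_qV.+1) (e X : K r s).

Local Notation KA := (A *t tinv M *t ttr A).
Local Notation KB := (ttr B *t tinv N *t B).
Local Notation sk_gain ij := (gain A B (skE A M S ij.1) (skG B N V ij.2)).
Local Notation sk_incr ij :=
  (increment A B M N (skE A M S ij.1) (skG B N V ij.2)).
Local Notation normMN := (tnormF2 M N).
Local Notation range := (sk_range A B M N).
Local Notation quotient := (sk_quotient A B M N S V).
Local Notation max_quotient := (sk_max_quotient A B M N S V).
Local Notation delta2 := (sk_delta2 A B M N S V).

Lemma skE_sketch i : skE A M S i = sketch (S i) KA.
Proof. by rewrite /skE /sketch !tmulA. Qed.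

Lemma skG_sketch j : skG B N V j = sketch (V j) KB.
Proof. by rewrite /skG /sketch !tmulA. Qed.

Lemma skE_ttr i : ttr (skE A M S i) = skE A M S i.
Proof. by rewrite skE_sketch sketch_ttr // ttrKA. Qed.

Lemma skG_ttr j : ttr (skG B N V j) = skG B N V j.
Proof. by rewrite skG_sketch sketch_ttr // ttrKB. Qed.

Lemma skE_mulK i : skE A M S i *t KA *t skE A M S i = skE A M S i.
Proof. by rewrite skE_sketch sketch_mulK. Qed.

Lemma skG_mulK j : skG B N V j *t KB *t skG B N V j = skG B N V j.
Proof. by rewrite skG_sketch sketch_mulK. Qed.

Lemma sk_gain_ge0 ij e : 0 <= sk_gain ij e.
Proof. exact: gain_ge0 (skE_ttr _) (skE_mulK _) (skG_ttr _) (skG_mulK _) _. Qed.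

Lemma sk_gain_le ij e : sk_gain ij e <= normMN e.
Proof. exact: gain_le (skE_ttr _) (skE_mulK _) (skG_ttr _) (skG_mulK _) _. Qed.

Lemma residualE Xstar X : A *t Xstar *t B = C ->
  A *t X *t B - C = A *t (X - Xstar) *t B.
Proof. by move=> <-; rewrite (tmulBr A) tmulBl. Qed.

Lemma sk_stepE Xstar ij X : A *t Xstar *t B = C ->
  sk_step A B C M N S V ij X - Xstar = (X - Xstar) - sk_incr ij (X - Xstar).
Proof. by move=> CE; rewrite /sk_step (residualE _ CE) addrAC. Qed.

Lemma sk_lossE Xstar ij X : A *t Xstar *t B = C ->
  sk_loss A B C M N S V ij X = sk_gain ij (X - Xstar).
Proof. by move=> CE; rewrite /sk_loss (residualE _ CE). Qed.

Lemma normMN_step Xstar ij X : A *t Xstar *t B = C ->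
  normMN (sk_step A B C M N S V ij X - Xstar) =
    normMN (X - Xstar) - sk_loss A B C M N S V ij X.
Proof.
move=> CE; rewrite (sk_stepE _ _ CE) (sk_lossE _ _ CE).
exact: normF2_sub_increment (skE_ttr _) (skE_mulK _) (skG_ttr _) (skG_mulK _) _.
Qed.

Lemma sk_rangeP y : range y <->
  exists U : K m n, y = vec_t (tinv M *t ttr A *t U *t (ttr B *t tinv N)).
Proof.
rewrite /sk_range -sliceT_ttr -sliceT_mul; split=> [[x _ <-]|[U ->]].
  by exists (mat_t x); rewrite -tkron_vec mat_tK.
by exists (vec_t U); rewrite ?tkron_vec.
Qed.

Lemma sk_rangeB x y : range x -> range y -> range (x - y).
Proof. by move=> [u _ <-] [v _ <-]; exists (u - v) => //; rewrite tmulBr. Qed.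

Lemma sk_range_increment ij e : range (vec_t (sk_incr ij e)).
Proof.
apply/sk_rangeP; rewrite /increment.
move: (skE _ _ _ _) (skG _ _ _ _) => E G.
by exists (E *t (A *t e *t B) *t G); rewrite !tmulA.
Qed.

Lemma sk_range_step Xstar ij X : A *t Xstar *t B = C ->
  range (vec_t (X - Xstar)) ->
  range (vec_t (sk_step A B C M N S V ij X - Xstar)).
Proof.
move=> CE rX; rewrite (sk_stepE _ _ CE) vec_tB.
exact: sk_rangeB rX (sk_range_increment _ _).
Qed.

Lemma normMN_ge0 e : 0 <= normMN e.
Proof. by rewrite tnormF2E tposdef_tinner_ge0. Qed.

Lemma tnorm2_gt0 (y : K (\sum_(j < s) r) 1) : y != 0 ->
  0 < tnorm2 (tkron (sliceT N) M) y.
Proof.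
move=> y0; rewrite -[y]mat_tK -/(normMN _) tnormF2E tposdef_tinner_gt0 //.
by apply: contra_neq y0 => my0; rewrite -[y]mat_tK my0 vec_t0.
Qed.

Lemma sk_quotient_vec ij e :
  0 <= quotient (vec_t e) ij <= sk_gain ij e / normMN e.
Proof.
rewrite /sk_quotient -/(normMN e) tkron_vec -/(tnormF2 _ _ _).
have g0 : 0 <= sk_gain ij e / normMN e.
  by rewrite divr_ge0 ?sk_gain_ge0 ?normMN_ge0.
have [->|->] := whitened_gain A B (skE A M S ij.1) (skG B N V ij.2) hM hN e.
  by rewrite g0 lexx.
by rewrite mul0r lexx g0.
Qed.

Lemma max_quotient_ge0 y : 0 <= max_quotient y.
Proof.
rewrite -[y]mat_tK; have /andP[q0 _] := sk_quotient_vec (ord0, ord0) (mat_t y).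
by apply: le_trans q0 _; exact: le_bigmax.
Qed.

Lemma delta2_le y : range y -> y != 0 -> delta2 <= max_quotient y.
Proof.
move=> ry y0; apply: ge_inf; last by exists y.
by exists 0 => _ [z _ <-]; exact: max_quotient_ge0.
Qed.

Lemma delta2_gain e ij : range (vec_t e) ->
    (forall ij', sk_gain ij' e <= sk_gain ij e) ->
  delta2 * normMN e <= sk_gain ij e.
Proof.
move=> re ij_max; have [->|e0] := eqVneq e 0.
  by rewrite tnormF2E tinner0r mulr0 sk_gain_ge0.
have norm_gt0 : 0 < normMN e by rewrite tnormF2E tposdef_tinner_gt0.
rewrite -ler_pdivlMr //; apply: le_trans (delta2_le re _) _.
  by apply: contra_neq e0; rewrite -(@vec_t0 R l); exact: vec_t_inj.
have q_le ij' : quotient (vec_t e) ij' <= sk_gain ij e / normMN e.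
  have /andP[_ q_gain] := sk_quotient_vec ij' e.
  by apply: le_trans q_gain _; rewrite ler_pM2r ?invr_gt0.
by apply: bigmax_le => // ij' _.
Qed.

Lemma sk_rho_ge0 : 0 <= sk_rho A B M N S V.
Proof.
rewrite subr_ge0.
have [[y [ry y0]]|no_y] := pselect (exists y, range y /\ y != 0); last first.
  rewrite /sk_delta2 (_ : [set _ | _ in _] = set0) ?inf0 ?ler01 //.
  by rewrite -subset0 => x [y yP _]; case: no_y; exists y.
apply: le_trans (delta2_le ry y0) _; rewrite -[y]mat_tK.
have q_le1 ij : quotient (vec_t (mat_t y)) ij <= 1.
  have /andP[_ q_gain] := sk_quotient_vec ij (mat_t y).
  have norm_gt0 : 0 < normMN (mat_t y) by rewrite /tnormF2 mat_tK tnorm2_gt0.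
  by apply: le_trans q_gain _; rewrite ler_pdivrMr // mul1r sk_gain_le.
by apply: bigmax_le.
Qed.

Lemma max_quotientZ a y : a != 0 -> max_quotient (a *: y) = max_quotient y.
Proof.
move=> a0.
have qZ ij : quotient (a *: y) ij = quotient y ij.
  rewrite /sk_quotient tmulZr /tnorm2 !tmulZr !tinnerZl !tinnerZr !mulrA.
  by rewrite -mulf_div divff ?mul1r // mulf_neq0.
by rewrite /sk_max_quotient qZ; apply: eq_bigr => ij _; rewrite qZ.
Qed.

Lemma delta2_attained : (exists y, range y /\ y != 0) ->
  exists y, [/\ range y, y != 0 & max_quotient y = delta2].
Proof.
move=> [y0 [ry0 y0_neq0]].
have [d [Y [YL Y_neq0 rangeY]]] :=
  trange_param (tkron (sliceT (tinv N) *t trev B) (tinv M *t ttr A)).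
have {}rangeY y : range y <-> exists v, y = Y v by exact: rangeY.
have Y0 : Y 0 = 0 by have := YL (-1) 0 0; rewrite scaler0 addr0 scaleN1r addNr.
have YZ a v : Y (a *: v) = a *: Y v by rewrite -[a *: v]addr0 YL Y0 addr0.
have [|v v_neq0|a v a0|v v_neq0 v_min] := @homogeneous_min R d (max_quotient \o Y).
- have [v y0E] := (rangeY y0).1 ry0; exists v.
  by apply: contra_neq y0_neq0 => v0; rewrite y0E v0 Y0.
- have q_cont ij : continuous_at v (fun u => quotient (Y u) ij).
    have num_cont : continuous (fun u => tnorm2
        (tkron (sliceT (skW B N V ij.2)) (skZ A M S ij.1))
        (tkron (sliceT (tsqrt N)) (tsqrt M) *t Y u) : R).
      by apply: tinner_continuous => // a u w; rewrite YL !(tmulDr, tmulZr).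
    have den_cont : continuous (fun u => tnorm2 (tkron (sliceT N) M) (Y u) : R).
      by apply: tinner_continuous => // a u w; rewrite YL tmulDr tmulZr.
    apply: (continuousM (num_cont v)); apply: continuousV (den_cont v).
    by rewrite gt_eqF // tnorm2_gt0 // Y_neq0.
  exact: bigmax_continuous.
- by rewrite /= YZ max_quotientZ.
have rYv : range (Y v) by rewrite rangeY; exists v.
exists (Y v); split => //; first exact: Y_neq0.
apply/eqP; rewrite eq_le delta2_le ?Y_neq0 ?andbT //.
apply: lb_le_inf; first by exists (max_quotient y0), y0.
move=> _ [z [/rangeY[w ->] z_neq0] <-]; apply: v_min.
by apply: contra_neq z_neq0 => ->; rewrite Y0.
Qed.

Section Run.
Variables (Xstar X0 : K r s).
Hypotheses (CE : A *t Xstar *t B = C) (hXstar : range (vec_t Xstar)).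
Hypothesis hX0 : range (vec_t X0).
Variables (d : measure_display) (Omega : measurableType d).
Variables (sel : nat -> Omega -> 'I_qS.+1 * 'I_qV.+1).
Variables (X : nat -> Omega -> K r s).
Hypothesis hX : ATESP_MD A B C M N S V X0 sel X.

Lemma run_range t w : range (vec_t (X t w - Xstar)).
Proof.
have [_ X0E _ XS] := hX; elim: t => [|t IHt].
  by rewrite X0E vec_tB; exact: sk_rangeB.
by rewrite XS; exact: sk_range_step.
Qed.

Lemma run_contracts t w :
  normMN (X t w - Xstar) <= sk_rho A B M N S V ^+ t * normMN (X0 - Xstar).
Proof.
have [_ X0E sel_max XS] := hX; elim: t => [|t IHt].
  by rewrite X0E expr0 mul1r.
rewrite exprS -mulrA; apply: le_trans (ler_wpM2l sk_rho_ge0 IHt).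
rewrite XS (normMN_step _ _ CE) /sk_rho mulrBl mul1r lerD2l lerN2.
rewrite (sk_lossE _ _ CE); apply: delta2_gain => [|ij]; first exact: run_range.
by rewrite -!(sk_lossE _ _ CE).
Qed.

Lemma run_measurable t (D : set (K r s)) : measurable [set w | D (X t w)].
Proof.
have [sel_meas X0E _ XS] := hX; elim: t D => [|t IHt] D.
  have [DX0|nDX0] := pselect (D X0).
    rewrite (_ : [set w | _] = setT) //.
    by apply/seteqP; split => // w _ /=; rewrite X0E.
  rewrite (_ : [set w | _] = set0) //.
  by apply/seteqP; split => // w /=; rewrite X0E.
rewrite (_ : [set w | _] = \bigcup_(ij in [set: 'I_qS.+1 * 'I_qV.+1])
   ([set w | sel t w = ij] `&`
    [set w | D (sk_step A B C M N S V ij (X t w))])).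
  apply: fin_bigcup_measurable => [|ij _]; first exact: finite_finset.
  apply: measurableI; first exact: sel_meas.
  exact: (IHt [set U | D (sk_step A B C M N S V ij U)]).
apply/seteqP; split => [w /=|w [ij _ [/= selE]]]; rewrite XS ?selE //.
by exists (sel t w).
Qed.

Lemma run_expectation (P : probability Omega R) t :
  ('E_P[fun w => tnormF2 M N (X t w - Xstar)%R]
     <= (sk_rho A B M N S V ^+ t * tnormF2 M N (X0 - Xstar))%R%:E)%E.
Proof.
rewrite -(expectation_cst P); apply: expectation_le => //.
- move=> _ U mU; rewrite setTI.
  exact: (run_measurable t [set W | U (tnormF2 M N (W - Xstar))]).
- by move=> w; exact: normMN_ge0.
- by move=> w; rewrite mulr_ge0 ?exprn_ge0 ?sk_rho_ge0 ?normMN_ge0.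
- by apply: aeW => w; exact: run_contracts.
Qed.

End Run.
End SketchAndProjectMethod.

Theorem theorem4 (R : realType) (l m r s n tau zeta qS qV : nat)
  (A : tubal R l.+1 m r) (B : tubal R l.+1 s n) (C : tubal R l.+1 m n)
  (M : tubal R l.+1 r r) (N : tubal R l.+1 s s)
  (hM : tposdef M) (hN : tposdef N)
  (S : 'I_qS.+1 -> tubal R l.+1 m tau) (V : 'I_qV.+1 -> tubal R l.+1 n zeta)
  (Xstar : tubal R l.+1 r s)
  (hXstar : A *t Xstar *t B = C)
  (hXstar_range : sk_range A B M N (vec_t Xstar))
  (d : measure_display) (Omega : measurableType d) (P : probability Omega R)
  (X0 : tubal R l.+1 r s)
  (hX0 : sk_range A B M N (vec_t X0))
  (sel : nat -> Omega -> 'I_qS.+1 * 'I_qV.+1)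
  (X : nat -> Omega -> tubal R l.+1 r s)
  (hX : ATESP_MD A B C M N S V X0 sel X) :
  (* the infimum defining delta_infty^2 is a minimum *)
  ((exists Y, sk_range A B M N Y /\ Y != 0) ->
     exists Y, [/\ sk_range A B M N Y, Y != 0 &
                   sk_max_quotient A B M N S V Y = sk_delta2 A B M N S V]) /\
  forall t : nat,
    ('E_P[fun w => tnormF2 M N (X t w - Xstar)%R]
       <= (sk_rho A B M N S V ^+ t * tnormF2 M N (X0 - Xstar))%R%:E)%E.
Proof.
split; first exact: (delta2_attained S V hM hN).
exact: (run_expectation hM hN hXstar hXstar_range hX0 hX P).
Qed.
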